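(* Let $1<q<\infty$ and $q^*=q/(q-1)$. Then $\pi_{2,q}/2^{2/q+1}=\pi_{q^*,q}/4$, and for all $x\in[0,\pi_{2,q}/2^{2/q+1})=[0,\pi_{q^*,q}/4)$, $$\sin_{2,q}(2^{2/q}x)=2^{2/q}\sin_{q^*,q}x\,\cos_{q^*,q}^{q^*-1}x,$$ $$\cos_{2,q}(2^{2/q}x)=\cos_{q^*,q}^{q^*}x-\sin_{q^*,q}^q x.$$ Moreover, for the same $x$, $$\sinh_{2q/(q+2),q}(2^{2/q}x)=\frac{2^{2/q}\sinh_{q/2,q}x}{(1-\sinh_{q/2,q}^q x)^{2/q}},$$ $$\cosh_{2q/(q+2),q}(2^{2/q}x)=\left(\frac{1+\sinh_{q/2,q}^q x}{1-\sinh_{q/2,q}^q x}\right)^{2/q+1}.$$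
   Context: For $1<q<\infty$ and $q/(q+1)<p<\infty$ (note that $p\le 1$ is allowed): Let $F_{p,q}(y)=\int_0^y \frac{dt}{(1-t^q)^{1/p}}$ for $y\in[0,1)$ and $\pi_{p,q}=2\int_0^1\frac{dt}{(1-t^q)^{1/p}}\in(0,\infty]$, which is finite for $p>1$ and equals $\infty$ for $p\le 1$. The function $\sin_{p,q}:[0,\pi_{p,q}/2)\to[0,1)$ is the inverse of $F_{p,q}$, and $\cos_{p,q}x=\frac{d}{dx}\sin_{p,q}x$ (one-sided derivative at $x=0$). Let $G_{p,q}(y)=\int_0^y \frac{dt}{(1+t^q)^{1/p}}$ for $y\in[0,\infty)$. With $r=r(p)$ defined by $\frac1p+\frac1r=1+\frac1q$ (so that $r>q/(q+1)$ as well), $\sinh_{p,q}:[0,\pi_{r,q}/2)\to[0,\infty)$ is the inverse of $G_{p,q}$ (one has $\lim_{y\to\infty}G_{p,q}(y)=\pi_{r,q}/2$), and $\cosh_{p,q}x=\frac{d}{dx}\sinh_{p,q}x$ (one-sided derivative at $x=0$). The notation $\sin_{p,q}^a x$ means $(\sin_{p,q}x)^a$, and similarly for the other functions. *)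

(* Defs.v *)
From HB Require Import structures.
From mathcomp Require Import all_boot all_order all_algebra.
From mathcomp Require Import all_classical all_reals all_analysis.
Set Implicit Arguments.
Unset Strict Implicit.
Unset Printing Implicit Defensive.
Import Order.TTheory GRing.Theory Num.Theory.
Import numFieldNormedType.Exports.
Local Open Scope classical_set_scope.
Local Open Scope ring_scope.

Section generalized_trigonometric_functions.
Variable R : realType.
Implicit Types p q x y : R.

Local Notation mu := (@lebesgue_measure R).

Definition arcsinpq p q y : R :=
  \int[mu]_(t in `[0, y]) ((1 - t `^ q) `^ p^-1)^-1.

(* Extended real: it is +oo exactly when the integral diverges (p <= 1). *)
Definition pipq p q : \bar R :=
  (2%:E * \int[mu]_(t in `[0%R, 1%R[) (((1 - t `^ q) `^ p^-1)^-1)%R%:E)%E.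

(* Inverse of arcsinpq p q on [0, 1[, hence meaningful on [0, pi_{p,q} / 2[;
   extended by 0 elsewhere. *)
Definition sinpq p q : R -> R := 'pinv_(fun=> 0) `[0, 1[ (arcsinpq p q).

Definition arcsinhpq p q y : R :=
  \int[mu]_(t in `[0, y]) ((1 + t `^ q) `^ p^-1)^-1.

(* Inverse of arcsinhpq p q on [0, +oo[, hence meaningful on
   [0, pi_{r,q} / 2[ with 1/p + 1/r = 1 + 1/q; extended by 0 elsewhere. *)
Definition sinhpq p q : R -> R := 'pinv_(fun=> 0) `[0, +oo[ (arcsinhpq p q).

(* Derivative of a function on an interval whose left endpoint 0 is included:
   right derivative at 0, ordinary derivative elsewhere. *)
Definition deriv_from0 (f : R -> R) x : R :=
  if x == 0 then lim ((f h - f 0) / h @[h --> 0^'+]) else derive1 f x.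

Definition cospq p q : R -> R := deriv_from0 (sinpq p q).

Definition coshpq p q : R -> R := deriv_from0 (sinhpq p q).

End generalized_trigonometric_functions.

(* Main.v *)
Require Import Defs.
From HB Require Import structures.
From mathcomp Require Import all_boot all_order all_algebra.
From mathcomp Require Import all_classical all_reals all_analysis.
From mathcomp Require Import ring lra.
Import Order.TTheory GRing.Theory Num.Theory.
Import numFieldNormedType.Exports.
Local Open Scope classical_set_scope.
Local Open Scope ring_scope.

(* No integral is ever substituted: two primitives are compared by checking
   that they have the same derivative and the same limit at 0+. Write
   F = arcsinpq, G = arcsinhpq, c = 2^(2/q), sg = 2^(-1/q). For s in [0, sg[,
     F_{2,q}(c s (1 - s^q)^(1/q)) = c F_{q',q}(s) = c G_{q/2,q}(u),
     with u = s (1 - s^q)^(-1/q) in [0, 1[, and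
     G_{2q/(q+2),q}(c u (1 - u^q)^(-2/q)) = c G_{q/2,q}(u);
   applying the inverse functions and their derivatives, which are the inverses
   of the integrands, gives the four double-angle formulas at x = F_{q',q}(s).
   The involution t |-> (1 - t^q)^(1/q), with fixed point sg, yields
   F_{q',q}(1-) = 2 F_{q',q}(sg), hence pi_{q',q} / 4 = F_{q',q}(sg), and the
   first substitution, as s tends to sg, yields pi_{2,q} / 2 = c F_{q',q}(sg). *)

(** * Primitives of positive integrands on an interval starting at 0, and their inverses *)

Section primitive.
#[local] Set Implicit Arguments.
#[local] Unset Strict Implicit.
Context {R : realType}.
Notation mu := (@lebesgue_measure R).

(** By the mean value theorem between [s] and [t]. The interval is open at 0, so nothing is asked of
    [h] there. *)
Lemma is_derive_eq0_cst (h : R -> R) (b : itv_bound R) :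
  {in Interval (BRight 0) b, forall s : R, is_derive s 1 h 0} ->
  {in Interval (BRight 0) b &, forall s t, h s = h t}.
Proof.
move=> dh.
suff H s t : s \in Interval (BRight 0) b -> t \in Interval (BRight 0) b ->
    s < t -> h s = h t.
  move=> s t sD tD; case: (ltgtP s t) => [st|ts|->//]; first exact: H.
  by apply/esym/H.
move=> sD tD st.
have I x : x \in `[s, t] -> x \in Interval (BRight 0) b.
  move=> xst; move: sD tD; rewrite !itv_boundlr !bnd_simp => /andP[s0 _] /andP[_ tb].
  rewrite (lt_le_trans s0) ?(itvP xst)//=; apply: le_trans tb.
  by rewrite bnd_simp (itvP xst).
have dhx x : x \in `]s, t[ -> is_derive x 1 h 0.
  by move=> xst; apply/dh/I; exact: subset_itv_oo_cc.
have [|c _ /eqP] := @MVT _ h (fun=> 0) s t st dhx.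
  apply: derivable_within_continuous => x /I /dh dx; exact: ex_derive.
by rewrite mul0r subr_eq0 => /eqP.
Qed.

(** The difference is constant on the interval and tends to [l - l] at 0+, so the constant is 0. *)
Lemma eq_derive_cvg0 (A B dA : R -> R) (l : R) (b : itv_bound R) :
  {in Interval (BRight 0) b, forall s : R, is_derive s 1 A (dA s)} ->
  {in Interval (BRight 0) b, forall s : R, is_derive s 1 B (dA s)} ->
  A @ 0^'+ --> l -> B @ 0^'+ --> l -> {in Interval (BRight 0) b, A =1 B}.
Proof.
move=> hA hB A0 B0 s sD; apply/eqP; rewrite -subr_eq0; apply/eqP.
have d0 : {in Interval (BRight 0) b, forall s : R, is_derive s 1 (A \- B) 0}.
  move=> t tD; have := hA _ tD; have := hB _ tD => dB dA'.
  by rewrite -(subrr (dA t)); exact: is_deriveB.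
have cst := is_derive_eq0_cst d0.
have : (A \- B) u @[u --> 0^'+] --> l - l by exact: cvgB.
rewrite subrr => AB0.
apply: (@cvg_unique _ _ ((A \- B) u @[u --> 0^'+])) => //.
have s0 : 0 < s by move: sD; rewrite itv_boundlr => /andP[].
apply: cvg_near_cst.
near=> u; apply: cst => //.
have u0 : 0 < u by [].
move: sD; rewrite !itv_boundlr !bnd_simp u0 andTb => /andP[_]; apply: le_trans.
by rewrite bnd_simp; near: u; exact: nbhs_right_le.
Unshelve. all: by end_near. Qed.

(* Continuity at 0 is only asked from the right, as t `^ q = 1 for t < 0. *)
Definition regular_integrand (f : R -> R) (b : itv_bound R) : Prop :=
  [/\ 0 \in Interval (BLeft 0) b,
      {in Interval (BLeft 0) b, forall y,
        exists2 z, y < z & z \in Interval (BLeft 0) b},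
      f @ 0^'+ --> f 0,
      {in Interval (BRight 0) b, continuous f} &
      {in Interval (BLeft 0) b, forall y, 0 < f y}].

Variables (f : R -> R) (b : itv_bound R).
Hypothesis fP : regular_integrand f b.

Let b_gt0 : 0 \in Interval (BLeft 0) b. Proof. by case: fP. Qed.

Let b_open : {in Interval (BLeft 0) b, forall y,
  exists2 z, y < z & z \in Interval (BLeft 0) b}.
Proof. by case: fP. Qed.

Let f_cvg0 : f @ 0^'+ --> f 0. Proof. by case: fP. Qed.

Let f_cont : {in Interval (BRight 0) b, continuous f}. Proof. by case: fP. Qed.

Let f_gt0 : {in Interval (BLeft 0) b, forall y, 0 < f y}. Proof. by case: fP. Qed.

Let F y : R := \int[mu]_(t in `[0, y]) f t.

Let lower x y : 0 <= x -> x <= y -> y \in Interval (BLeft 0) b ->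
  x \in Interval (BLeft 0) b.
Proof.
move=> x0 xy; rewrite !itv_boundlr !bnd_simp x0 andTb => /andP[_]; apply: le_trans.
by rewrite bnd_simp.
Qed.

Let pos x : 0 < x -> x \in Interval (BLeft 0) b -> x \in Interval (BRight 0) b.
Proof. by move=> x0; rewrite !itv_boundlr !bnd_simp x0 => /andP[]. Qed.

Let posW x : x \in Interval (BRight 0) b -> x \in Interval (BLeft 0) b.
Proof. by rewrite !itv_boundlr !bnd_simp => /andP[/ltW-> ->]. Qed.

Lemma primitive0 : F 0 = 0.
Proof. by rewrite /F set_itv1 Rintegral_set1. Qed.

Lemma integrand_within_continuous y : y \in Interval (BLeft 0) b ->
  {within `[0, y], continuous f}.
Proof.
move=> yD; have [<-|y0] := eqVneq 0 y.
  by rewrite set_itv1; exact: continuous_subspace1.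
have {}y0 : 0 < y by rewrite lt_neqAle y0; move: yD; rewrite itv_boundlr => /andP[].
apply/continuous_within_itvP => //; split => //.
  move=> x /[!in_itv]/= /andP[x0 xy]; apply: f_cont; apply: pos => //.
  by apply: lower yD; exact: ltW.
by apply: cvg_at_left_filter; exact: (f_cont (pos y0 yD)).
Qed.

Lemma integrand_integrable y : y \in Interval (BLeft 0) b ->
  mu.-integrable `[0, y] (EFin \o f).
Proof.
move=> yD; apply: continuous_compact_integrable; first exact: segment_compact.
exact: integrand_within_continuous.
Qed.

(** Openness at [b] supplies [z > y], so [y] is interior to [[0, z]], where the fundamental theorem
    of calculus applies. *)
Lemma is_derive_primitive :
  {in Interval (BRight 0) b, forall y : R, is_derive y 1 F (f y)}.
Proof.
move=> y yD; have [z yz zD] := b_open (posW yD).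
have y0 : 0 < y by move: yD; rewrite itv_boundlr => /andP[].
have [dF F'] := continuous_FTC1_closed yz (integrand_integrable zD) y0 (f_cont yD).
by apply: DeriveDef; [exact: dF|rewrite -derive1E; exact: F'].
Qed.

Lemma primitive_cvg0 : F @ 0 --> 0.
Proof.
have [z z0 zD] := b_open b_gt0.
exact: (parameterized_integral_cvg_left z0 (integrand_integrable zD)).
Qed.

Lemma primitive_continuous : {in Interval (BLeft 0) b, continuous F}.
Proof.
move=> y yD; have [y0|y0] := eqVneq y 0.
  by rewrite y0 /continuous_at primitive0; exact: primitive_cvg0.
have /is_derive_primitive dF : y \in Interval (BRight 0) b.
  by apply: pos => //; rewrite lt_neqAle eq_sym y0; move: yD; rewrite itv_boundlr => /andP[].
by apply: differentiable_continuous; apply/derivable1_diffP; exact: ex_derive.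
Qed.

Lemma primitive_MVT x y : 0 <= x -> x < y -> y \in Interval (BLeft 0) b ->
  exists2 c, c \in `]x, y[ & F y - F x = f c * (y - x).
Proof.
move=> x0 xy yD; apply: MVT => //.
  move=> c /[!in_itv]/= /andP[xc cy]; apply: is_derive_primitive.
  have c0 := le_lt_trans x0 xc.
  by apply: pos => //; apply: lower yD => //; exact: ltW.
apply: continuous_in_subspaceT => c /[!inE]/= /[!in_itv]/= /andP[xc cy].
by apply: primitive_continuous; apply: lower yD => //; exact: le_trans xc.
Qed.

Lemma primitive_lt : {in Interval (BLeft 0) b &, {homo F : x y / x < y}}.
Proof.
move=> x y xD yD xy.
have x0 : 0 <= x by move: xD; rewrite itv_boundlr => /andP[].
have [c /[!in_itv]/= /andP[xc cy] FE] := primitive_MVT x0 xy yD.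
rewrite -subr_gt0 FE mulr_gt0 ?subr_gt0// f_gt0//.
by apply: lower yD; [exact: le_trans (ltW xc)|exact: ltW].
Qed.

Lemma primitive_inj : {in Interval (BLeft 0) b &, injective F}.
Proof.
move=> x y xD yD Fxy; case: (ltgtP x y) => // /primitive_lt H.
  by have := H xD yD; rewrite Fxy ltxx.
by have := H yD xD; rewrite Fxy ltxx.
Qed.

Local Notation G := ('pinv_(fun=> 0) [set` Interval (BLeft 0) b] F).

Lemma primitiveK : {in Interval (BLeft 0) b, cancel F G}.
Proof.
move=> y yD; apply: pinvKV; last by rewrite inE.
by move=> u v; rewrite !inE; exact: primitive_inj.
Qed.

(** For [y > 0] this is the derivative of an inverse function. At 0 only the right difference
    quotient makes sense, and the mean value theorem compares it with [f]. *)
Lemma deriv_from0_primitive_inverse :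
  {in Interval (BLeft 0) b, forall y, deriv_from0 G (F y) = (f y)^-1}.
Proof.
move=> y yD.
have [y0|y0] := eqVneq y 0; last first.
  have {}y0 : 0 < y.
    by rewrite lt_neqAle eq_sym y0; move: yD; rewrite itv_boundlr => /andP[].
  (* Since [F y] is nonzero, [deriv_from0] takes its ordinary branch. *)
  have Fy0 : 0 < F y by rewrite -primitive0 primitive_lt.
  rewrite /deriv_from0 gt_eqF// derive1E.
  have [z yz zD] := b_open yD.
  have yP := pos y0 yD.
  have inD : \forall t \near y, t \in Interval (BLeft 0) b.
    near=> t; apply: (lower _ _ zD).
      by apply: ltW; near: t; exact: lt_nbhsr.
    by apply: ltW; near: t; exact: lt_nbhsl.
  have [] := @is_derive_inverse _ F G (f y) y.
  - by near=> t; apply: primitiveK; near: t.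
  - by near=> t; apply: primitive_continuous; near: t.
  - exact: is_derive_primitive.
  - by rewrite gt_eqF// f_gt0.
  - by [].
(* At 0: the difference quotient at h = F x is x / F x = (f c)^-1 for some c in
   ]0, x[. *)
have G0 : G 0 = 0 by rewrite -[X in G X]primitive0 primitiveK.
rewrite /deriv_from0 y0 primitive0 eqxx G0; apply: cvg_lim => //.
under eq_fun do rewrite subr0.
have f0 := f_gt0 b_gt0.
have : (f x)^-1 @[x --> 0^'+] --> (f 0)^-1 by apply: cvgV => //; rewrite gt_eqF.
move=> /cvgrPdist_lt fV; apply/cvgrPdist_lt => e e0.
have [z z0 zD] := b_open b_gt0.
have [d /= d0 {}fV] := fV _ e0.
(* [z] keeps [m] in the domain, and [d / 2] puts every [c < m] within [d] of 0. *)
pose m := Num.min z (d / 2).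
have m0 : 0 < m by rewrite lt_min z0 divr_gt0.
have mD : m \in Interval (BLeft 0) b.
  by apply: lower zD; [exact: ltW|rewrite ge_min lexx].
have Fm0 : 0 < F m by rewrite -primitive0 primitive_lt.
near=> h.
have h0 : 0 < h by [].
have hm : h <= F m by near: h; exact: nbhs_right_le.
(* The intermediate value theorem writes the increment [h] as [F x] with [x <= m]. *)
have [||x /[!in_itv]/= /andP[x0 xm] Fx] := @IVT _ F 0 m h (ltW m0).
- apply: continuous_in_subspaceT => c /[!inE]/= /[!in_itv]/= /andP[c0 cm].
  by apply: primitive_continuous; apply: lower mD.
- by rewrite primitive0 ge_min le_max (ltW h0) hm !orbT.
have {}x0 : 0 < x.
  rewrite lt_neqAle x0 andbT; apply: contraTneq h0 => xE.
  by rewrite -Fx -xE primitive0 ltxx.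
have xD : x \in Interval (BLeft 0) b by apply: lower mD => //; exact: ltW.
have [c /[!in_itv]/= /andP[c0 cx]] := primitive_MVT (lexx 0) x0 xD.
rewrite primitive0 !subr0 Fx => hE.
rewrite -{1}Fx primitiveK// hE invfM mulrCA divff ?gt_eqF// mulr1.
apply: fV => //=; rewrite sub0r normrN gtr0_norm// (lt_le_trans cx)//.
rewrite (le_trans xm)// ge_min; apply/orP; right.
by rewrite ler_pdivrMr// ler_peMr ?ler1n// ltW.
Unshelve. all: by end_near. Qed.

(** Replaces a change of variables: by the chain rule [F \o phi] has derivative [dA], and both sides
    tend to 0 at 0+. *)
Lemma primitive_comp (phi dphi A dA : R -> R) (c : itv_bound R) :
  {in Interval (BRight 0) c, forall s, phi s \in Interval (BRight 0) b} ->
  {in Interval (BRight 0) c, forall s : R, is_derive s 1 phi (dphi s)} ->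
  {in Interval (BRight 0) c, forall s : R, is_derive s 1 A (dA s)} ->
  {in Interval (BRight 0) c, forall s, f (phi s) * dphi s = dA s} ->
  phi @ 0^'+ --> 0 -> A @ 0^'+ --> 0 ->
  {in Interval (BRight 0) c, forall s, F (phi s) = A s}.
Proof.
move=> phiD phi' A' fphi phi0 A0 s sD.
apply: (@eq_derive_cvg0 (F \o phi) A dA 0 c) => //.
- move=> t tD; rewrite -fphi//; apply: is_derive1_comp; last exact: phi'.
  exact/is_derive_primitive/phiD.
- by apply: cvg_comp phi0 _; exact: primitive_cvg0.
Qed.

End primitive.

(** * Limits and derivatives of real powers *)

Section powR_complements.
Context {R : realType}.
Implicit Types a r x : R.

Lemma cvg_powR {T : Type} (F : set_system T) {FF : Filter F} (g : T -> R) a r :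
  0 < a -> g @ F --> a -> g x `^ r @[x --> F] --> a `^ r.
Proof.
move=> a0 ga; have : {for a, continuous (@powR R ^~ r)}.
  apply: differentiable_continuous; apply/derivable1_diffP.
  by apply: derivable_powR; rewrite in_itv/= a0.
exact: cvg_comp ga.
Qed.

Lemma powR_lt1 x r : 0 < r -> 0 <= x -> x < 1 -> x `^ r < 1.
Proof.
move=> r0 x0 x1; have := gt0_ltr_powR r0 (x := x) (y := 1).
by rewrite powR1 !nnegrE; apply.
Qed.

Lemma powRVK x r : 0 <= x -> r != 0 -> (x `^ r^-1) `^ r = x.
Proof. by move=> x0 r0; rewrite -powRrM mulVf// powRr1. Qed.

Lemma powRVl x r : 0 <= x -> (x^-1) `^ r = (x `^ r)^-1.
Proof. by move=> x0; rewrite -powR_inv1// -powRrM mulN1r powRN. Qed.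

Lemma powR_sqr x r : 0 <= x -> (x ^+ 2) `^ r = x `^ (2 * r).
Proof. by move=> x0; rewrite -powR_mulrn// -powRrM. Qed.

Lemma powR_sqr_half x : 0 <= x -> (x ^+ 2) `^ 2^-1 = x.
Proof. by move=> x0; rewrite powR12_sqrt ?sqr_ge0// sqrtr_sqr ger0_norm. Qed.

Lemma powR_mul_subr1 x r : 0 < x -> x * x `^ (r - 1) = x `^ r.
Proof.
move=> x0; rewrite -{1}[x]powRr1 ?ltW// -powRD; last by rewrite (gt_eqF x0) implybT.
by congr (_ `^ _); ring.
Qed.

Lemma powR_lt1_inv x r : 0 < r -> 0 <= x -> x `^ r < 1 -> x < 1.
Proof.
move=> r0 x0; apply: contraTT; rewrite -!leNgt => x1.
have := ge0_ler_powR (ltW r0) (x := 1) (y := x).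
by rewrite powR1 !nnegrE; apply.
Qed.

(** Complements [cvg_powR], which asks for a positive limit. Nonnegativity near the limit matters,
    because a negative base has power 1. *)
Lemma cvg_powR0 {T : Type} (F : set_system T) {FF : Filter F} (g : T -> R) r :
  0 < r -> (\forall x \near F, 0 <= g x) -> g @ F --> 0 ->
  g x `^ r @[x --> F] --> 0.
Proof.
move=> r0 g0 gF; apply/cvgrPdist_lt => e e0.
have /cvgrPdist_lt/(_ _ e0) [d /= d0 H] := powR_cvg0 r0.
move/cvgrPdist_lt : gF => /(_ _ d0) gF.
near=> x.
have := near g0 x; have : 0 <= g x by near: x.
(* The value [g x = 0] is treated apart, since [powR_cvg0] is a limit at 0+ and says nothing at
   0. *)
rewrite le_eqVlt => /predU1P[<- _|gx0 _].
  by rewrite powR0 ?gt_eqF// subrr normr0.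
by apply: H => //=; near: x.
Unshelve. all: by end_near. Qed.

Lemma onem_powR_cvg0 (q r : R) : 0 < q -> 0 < r ->
  (1 - s `^ q) `^ r @[s --> 1^'-] --> 0.
Proof.
move=> q0 r0; apply: cvg_powR0 => //.
  near=> s; rewrite subr_ge0 ltW// powR_lt1//.
  by near: s; apply: nbhs_left_ge.
rewrite -(subrr 1); apply: cvgB; first exact: cvg_cst.
rewrite [X in _ --> X](_ : 1 = 1 `^ q); last by rewrite powR1.
by apply: cvg_powR => //; exact: cvg_at_left_filter.
Unshelve. all: by end_near. Qed.

Lemma is_derive_onem_powR (q r s : R) : 0 < q -> 0 < s -> s < 1 ->
  is_derive s 1 (fun t => (1 - t `^ q) `^ r)
    (r * (1 - s `^ q) `^ (r - 1) * (- (q * s `^ (q - 1)))).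
Proof.
move=> q0 s0 s1.
have S0 : 0 < 1 - s `^ q by rewrite subr_gt0 powR_lt1// ltW.
have := is_deriveB (is_derive_cst (1 : R) s 1) (is_derive1_powR q s0).
rewrite sub0r => dS.
exact: (@is_derive1_comp _ (@powR R ^~ r) (fun t => 1 - t `^ q) s _ _
  (is_derive1_powR r S0) dS).
Qed.

(** All the substitutions have this shape up to a constant, with [r] equal to 1/q, -1/q or -2/q. The
    last factor then becomes 1 - 2S, 1 or 1 + S, where S = s^q. *)
Lemma is_derive_mul_onem_powR (q r s : R) : 0 < q -> 0 < s -> s < 1 ->
  is_derive s 1 (fun t => t * (1 - t `^ q) `^ r)
    ((1 - s `^ q) `^ (r - 1) * (1 - s `^ q - r * q * s `^ q)).
Proof.
move=> q0 s0 s1.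
have S0 : 0 < 1 - s `^ q by rewrite subr_gt0 powR_lt1// ltW.
have /(is_deriveM (is_derive_id s 1)) H := is_derive_onem_powR q r s q0 s0 s1.
apply: is_derive_eq H _.
rewrite /= -(powR_mul_subr1 _ r S0) -(powR_mul_subr1 _ q s0) !scaler1 /GRing.scale/=.
ring.
Qed.

End powR_complements.

(** * The generalized sine and hyperbolic sine as inverses of primitives, and pi as a limit *)

Section integrands.
Context {R : realType}.
Notation mu := (@lebesgue_measure R).
Variables (p q : R).
Hypothesis q0 : 0 < q.

Lemma regular_sin_integrand :
  regular_integrand (fun t => ((1 - t `^ q) `^ p^-1)^-1) (BLeft (1 : R)).
Proof.
have f0 (y : R) : y \in `[0, 1[ -> 0 < 1 - y `^ q.
  by rewrite in_itv/= => /andP[y0 y1]; rewrite subr_gt0 powR_lt1.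
split.
- by rewrite in_itv/= lexx ltr01.
- move=> y /[!in_itv]/= /andP[y0 y1]; exists ((y + 1) / 2); first lra.
  rewrite in_itv/=; lra.
- rewrite powR0 ?gt_eqF// subr0; apply: cvgV; first by rewrite powR1 oner_eq0.
  apply: cvg_powR => //; rewrite -[X in _ --> X]subr0.
  by apply: cvgB; [exact: cvg_cst|exact: powR_cvg0].
- move=> y yD; have /f0 fy : y \in `[0, 1[ by exact: subset_itv_oo_co.
  move: yD; rewrite in_itv/= => /andP[y0 _].
  apply: cvgV; first by rewrite gt_eqF// powR_gt0.
  apply: cvg_powR => //; apply: cvgB; [exact: cvg_cst|exact: cvg_powR].
- by move=> y /f0 fy; rewrite invr_gt0 powR_gt0.
Qed.

Lemma regular_sinh_integrand :
  regular_integrand (fun t => ((1 + t `^ q) `^ p^-1)^-1) (+oo%O : itv_bound R).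
Proof.
have f0 (y : R) : 0 < 1 + y `^ q by rewrite ltr_wpDr// powR_ge0.
split.
- by rewrite in_itv/= lexx.
- move=> y /[!in_itv]/= /andP[y0 _]; exists (y + 1); first lra.
  rewrite in_itv/=; lra.
- rewrite powR0 ?gt_eqF// addr0; apply: cvgV; first by rewrite powR1 oner_eq0.
  apply: cvg_powR => //; rewrite -[X in _ --> X]addr0.
  by apply: cvgD; [exact: cvg_cst|exact: powR_cvg0].
- move=> y; rewrite in_itv/= andbT => y0.
  apply: cvgV; first by rewrite gt_eqF// powR_gt0.
  apply: cvg_powR => //; apply: cvgD; [exact: cvg_cst|exact: cvg_powR].
- by move=> y _; rewrite invr_gt0 powR_gt0.
Qed.

Lemma arcsinpqK : {in `[0, 1[, cancel (arcsinpq p q) (sinpq p q)}.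
Proof. exact: primitiveK regular_sin_integrand. Qed.

Lemma cospq_arcsinpq (y : R) : y \in `[0, 1[ ->
  cospq p q (arcsinpq p q y) = (1 - y `^ q) `^ p^-1.
Proof.
move=> yD; rewrite -[RHS]invrK.
exact: (deriv_from0_primitive_inverse regular_sin_integrand).
Qed.

Lemma arcsinhpqK : {in `[0, +oo[, cancel (arcsinhpq p q) (sinhpq p q)}.
Proof. exact: primitiveK regular_sinh_integrand. Qed.

Lemma coshpq_arcsinhpq (y : R) : y \in `[0, +oo[ ->
  coshpq p q (arcsinhpq p q y) = (1 + y `^ q) `^ p^-1.
Proof.
move=> yD; rewrite -[RHS]invrK.
exact: (deriv_from0_primitive_inverse regular_sinh_integrand).
Qed.

(** Monotone convergence along the segments [[0, y n]], which exhaust [[0, 1[], turns the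
    extended-real integral into the left limit of [arcsinpq p q] at 1. *)
Lemma pipq_cvg (L : R) :
  arcsinpq p q @ 1^'- --> L -> pipq p q = (2 * L)%:E.
Proof.
move=> FL; rewrite /pipq EFinM; congr (_ * _)%E.
set f := fun t : R => (((1 - t `^ q) `^ p^-1)^-1)%:E.
pose y n : R := 1 - n.+1%:R^-1.
have yD n : y n \in `[0, 1[.
  rewrite in_itv/= subr_ge0 invf_le1// ler1n/=.
  by rewrite ltrBlDr ltrDl invr_gt0.
have yS : (\bigcup_n `[0, y n] = `[0, 1[)%classic.
  apply/seteqP; split => [x [n _] /=|x/=].
    have := yD n; rewrite !in_itv/= => /andP[_ y1] /andP[-> xy] /=.
    exact: le_lt_trans y1.
  rewrite in_itv/= => /andP[x0 x1].
  have [n nx] := ltr_add_invr x1.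
  by exists n => //=; rewrite in_itv/= x0 lerBrDr ltW.
have int n : mu.-integrable `[0, y n] f.
  exact: (integrand_integrable regular_sin_integrand (yD n)).
have := @ge0_nondecreasing_set_cvg_integral _ (measurableTypeR R) R
  (fun n => `[0, y n]%classic) f lebesgue_measure.
rewrite yS => H; rewrite -(cvg_lim (@ereal_hausdorff R) (H _ _ _ _)).
- apply: cvg_lim => //; apply/fine_cvgP; split.
    by near=> n; apply: integrable_fin_num.
  (* Sequential form of the left limit, along [y n < 1] tending to 1. *)
  apply: ((cvg_at_leftP _ _ _).1 FL); split.
    by move=> n; have := yD n; rewrite in_itv/= => /andP[].
  rewrite -[X in _ --> X]subr0; apply: cvgB; first exact: cvg_cst.
  exact: cvg_harmonic.
- apply/nondecreasing_seqP => n; rewrite subsetEset.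
  by apply: subset_itvl; rewrite bnd_simp lerB// lef_pV2 ?posrE// ler_nat.
- by move=> n; exact: measurable_itv.
- by move=> n; case/integrableP: (int n).
- by move=> n x _; rewrite lee_fin invr_ge0 powR_ge0.
Unshelve. all: by end_near. Qed.

End integrands.

(** * The substitutions between the integrals, and the values of pi *)

Section identities.
Context {R : realType}.
Notation mu := (@lebesgue_measure R).
Variable (q : R).
Hypothesis q1 : 1 < q.

Let q0 : 0 < q. Proof. exact: lt_trans q1. Qed.

Local Notation q' := (q / (q - 1)).
Local Notation c := ((2 : R) `^ (2 / q)).
Local Notation sg := ((2^-1 : R) `^ q^-1).

Let q'V : q'^-1 = 1 - q^-1.
Proof. by field; rewrite !(gt_eqF q0) gt_eqF ?subr_gt0. Qed.

Let sg_gt0 : 0 < sg. Proof. by rewrite powR_gt0. Qed.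

Let sg_lt1 : sg < 1.
Proof. by apply: powR_lt1; [rewrite invr_gt0|lra|lra]. Qed.

Let sgq : sg `^ q = 2^-1.
Proof. by rewrite powRVK// gt_eqF. Qed.

Let powq_lt1 (s : R) : 0 <= s -> s < 1 -> s `^ q < 1.
Proof. exact: powR_lt1. Qed.

Let powq_lthalf (s : R) : 0 <= s -> s < sg -> s `^ q < 2^-1.
Proof.
by move=> s0 ss; rewrite -sgq; apply: gt0_ltr_powR; rewrite ?nnegrE// ltW.
Qed.

Let integrandE (s : R) : ((1 - s `^ q) `^ q'^-1)^-1 = (1 - s `^ q) `^ (q^-1 - 1).
Proof. by rewrite q'V -powRN opprB. Qed.

Let dF (s : R) : 0 < s -> s < 1 ->
  is_derive s 1 (arcsinpq q' q) ((1 - s `^ q) `^ (q^-1 - 1)).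
Proof.
move=> s0 s1; rewrite -integrandE.
by apply: (is_derive_primitive (regular_sin_integrand q' q q0)); rewrite in_itv/= s0.
Qed.

(** With t = (1 - s^q)^(1/q) one has 1 - t^q = s^q, so the derivative of the second term is opposite
    to that of the first. The sum is constant, and its value is read at the fixed point [sg]. *)
Lemma arcsinpq_conj_sym (s : R) : 0 < s -> s < 1 ->
  arcsinpq q' q s + arcsinpq q' q ((1 - s `^ q) `^ q^-1) = 2 * arcsinpq q' q sg.
Proof.
move=> s0 s1.
pose h := arcsinpq q' q \+ (arcsinpq q' q \o (fun t => (1 - t `^ q) `^ q^-1)).
have := @is_derive_eq0_cst _ h (BLeft 1) _ s sg.
have half : 1 - 2^-1 = 2^-1 :> R by field.
rewrite /h /= sgq half -mulr2n -[RHS]mulr_natl => ->//;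
  rewrite ?in_itv/= ?s0 ?s1 ?sg_gt0 ?sg_lt1//.
move=> {s s0 s1} s /[!in_itv]/= /andP[s0 s1].
have S1 := powq_lt1 _ (ltW s0) s1.
have S0 : 0 < s `^ q by rewrite powR_gt0.
have T0 : 0 < 1 - s `^ q by rewrite subr_gt0.
have dphi := is_derive_onem_powR q q^-1 s q0 s0 s1.
set t := (1 - s `^ q) `^ q^-1 in dphi *.
have tq : t `^ q = 1 - s `^ q by rewrite powRVK// ?gt_eqF// ltW.
have t0 : 0 < t by rewrite powR_gt0.
have t1 : t < 1 by apply: powR_lt1; rewrite ?invr_gt0// ?ltW// ltrBlDr ltrDl.
have dFt := dF _ t0 t1.
have := is_deriveD (dF _ s0 s1) (@is_derive1_comp _ (arcsinpq q' q)
  (fun t => (1 - t `^ q) `^ q^-1) s _ _ dFt dphi).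
rewrite tq subKr => H; apply: is_derive_eq H _.
(* This factor cancels the s^(q-1) produced by differentiating t. *)
have -> : (s `^ q) `^ (q^-1 - 1) = (s `^ (q - 1))^-1.
  by rewrite -powRrM -powRN; congr (_ `^ _); field; rewrite gt_eqF.
by field; rewrite !gt_eqF ?powR_gt0.
Qed.

(** As s tends to 1, the conjugate point (1 - s^q)^(1/q) tends to 0 and so does its primitive; the
    symmetry gives the limit. *)
Lemma arcsinpq_conj_cvg1 : arcsinpq q' q @ 1^'- --> 2 * arcsinpq q' q sg.
Proof.
have H : (1 - s `^ q) `^ q^-1 @[s --> (1 : R)^'-] --> 0.
  by apply: onem_powR_cvg0; rewrite ?invr_gt0.
have : (2 * arcsinpq q' q sg - arcsinpq q' q ((1 - s `^ q) `^ q^-1))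
    @[s --> (1 : R)^'-] --> 2 * arcsinpq q' q sg - 0.
  apply: cvgB; first exact: cvg_cst.
  exact: (cvg_comp _ _ H (primitive_cvg0 (regular_sin_integrand q' q q0))).
rewrite subr0; apply: cvg_trans; apply: near_eq_cvg.
near=> s; apply/eqP; rewrite subr_eq; apply/eqP; by rewrite arcsinpq_conj_sym.
Unshelve. all: by end_near. Qed.

Lemma pipq_conj : pipq q' q = (2 * (2 * arcsinpq q' q sg))%:E.
Proof. exact/pipq_cvg/arcsinpq_conj_cvg1. Qed.

Let cq : c `^ q = 4.
Proof.
by rewrite -powRrM divfK ?gt_eqF// (powR_mulrn 2)//; ring.
Qed.

(** Common frame of the three substitutions, used with (k, r, e) equal to ([c], 1/q, [sg]), (1,
    -1/q, 1) and ([c], -2/q, 1). Each use is left with the range of the substitution and one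
    identity between integrands. *)
Let primitive_comp_onem (f1 f2 : R -> R) (b1 b2 : itv_bound R) (k r e : R) :
  regular_integrand f1 b1 -> regular_integrand f2 b2 ->
  e <= 1 -> (BLeft e <= b2)%O ->
  {in `]0, e[, forall s, k * (s * (1 - s `^ q) `^ r) \in Interval (BRight 0) b1} ->
  {in `]0, e[, forall s, f1 (k * (s * (1 - s `^ q) `^ r)) *
     ((1 - s `^ q) `^ (r - 1) * (1 - s `^ q - r * q * s `^ q)) = f2 s} ->
  {in `[0, e[, forall s, \int[mu]_(t in `[0, k * (s * (1 - s `^ q) `^ r)]) f1 t =
    k * \int[mu]_(t in `[0, s]) f2 t}.
Proof.
move=> f1P f2P e1 eb2 phiD f12 s.
(* At s = 0 both integrals vanish; [primitive_comp] covers only s > 0. *)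
rewrite in_itv/= le_eqVlt => /andP[/predU1P[<- _|s0 se]].
  by rewrite mul0r mulr0 !primitive0 mulr0.
apply: (@primitive_comp _ _ _ f1P
   (fun s => k * (s * (1 - s `^ q) `^ r))
   (fun s => k * ((1 - s `^ q) `^ (r - 1) * (1 - s `^ q - r * q * s `^ q)))
   (fun s => k * \int[mu]_(t in `[0, s]) f2 t)
   (fun s => k * f2 s) (BLeft e)) => //; last first.
- by rewrite in_itv/= s0.
- rewrite -[X in _ --> X](mulr0 k); apply: cvgM; first exact: cvg_cst.
  exact/cvg_at_right_filter/(primitive_cvg0 f2P).
- rewrite -[X in _ --> X](mulr0 k); apply: cvgM; first exact: cvg_cst.
  rewrite -[X in _ --> X](mul0r (1 `^ r)); apply: cvgM.
    exact/cvg_at_right_filter/cvg_id.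
  apply: cvg_powR => //; rewrite -[X in _ --> X]subr0.
  by apply: cvgB; [exact: cvg_cst|exact: powR_cvg0].
- by move=> t tD; rewrite -f12// mulrCA.
- move=> t /[!in_itv]/= /andP[t0 te].
  apply: (is_deriveZ k); apply: (is_derive_primitive f2P).
  by rewrite itv_boundlr bnd_simp t0; apply: le_trans eb2; rewrite bnd_simp.
- move=> t /[!in_itv]/= /andP[t0 te].
  apply: (is_deriveZ k); apply: is_derive_mul_onem_powR => //.
  exact: lt_le_trans e1.
Qed.

Let S01 (s : R) : s \in `]0, 1[ -> 0 < s `^ q < 1.
Proof. by rewrite in_itv/= => /andP[s0 s1]; rewrite powR_gt0// powq_lt1// ltW. Qed.

Let Shalf (s : R) : s \in `]0, sg[ -> 0 < s `^ q < 2^-1.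
Proof.
by rewrite in_itv/= => /andP[s0 s1]; rewrite powR_gt0// powq_lthalf// ltW.
Qed.

Lemma powR_onem_double (s : R) : 0 <= s -> s `^ q <= 1 ->
  (c * (s * (1 - s `^ q) `^ q^-1)) `^ q = 4 * (s `^ q * (1 - s `^ q)).
Proof.
move=> s0 s1; rewrite !powRM ?mulr_ge0 ?powR_ge0// cq powRVK ?gt_eqF//.
by rewrite subr_ge0.
Qed.

(** With S = s^q, the square root of 1 - 4S(1 - S) = (1 - 2S)^2 cancels the derivative factor 1 -
    2S. This factor is positive exactly because s < [sg]. *)
Lemma arcsin2q_comp (s : R) : s \in `[0, sg[ ->
  arcsinpq 2 q (c * (s * (1 - s `^ q) `^ q^-1)) = c * arcsinpq q' q s.
Proof.
apply: (primitive_comp_onem _ _ _ _ _ _ _ (regular_sin_integrand 2 q q0)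
  (regular_sin_integrand q' q q0) (ltW sg_lt1)); first by rewrite bnd_simp ltW.
  move=> {}s sD; have /andP[S0 S1] := Shalf _ sD.
  move: sD; rewrite !in_itv/= => /andP[s0 ss].
  have T0 : 0 < 1 - s `^ q by lra.
  have phi0 : 0 < c * (s * (1 - s `^ q) `^ q^-1) by rewrite !mulr_gt0 ?powR_gt0.
  rewrite phi0/=; apply: (powR_lt1_inv _ q); rewrite ?(ltW phi0)//.
  rewrite powR_onem_double ?(ltW s0)//; nra.
move=> {}s sD; have /andP[S0 S1] := Shalf _ sD.
move: sD; rewrite !in_itv/= => /andP[s0 ss].
have T0 : 0 < 1 - s `^ q by lra.
rewrite [RHS]integrandE (powR_onem_double _ (ltW s0)); last lra.
have -> : 1 - 4 * (s `^ q * (1 - s `^ q)) = (1 - 2 * s `^ q) ^+ 2 by ring.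
rewrite powR_sqr_half; last lra.
by field; rewrite !gt_eqF//; lra.
Qed.

(** With u = s (1 - s^q)^(-1/q) one has 1 + u^q = 1/(1 - s^q), and the derivative of u is (1 -
    s^q)^(-1/q-1), so only the exponents of 1 - s^q need to be added. *)
Lemma arcsinhhalf_comp (s : R) : s \in `[0, 1[ ->
  arcsinhpq (q / 2) q (s * (1 - s `^ q) `^ (- q^-1)) = arcsinpq q' q s.
Proof.
(* Inserts the constant k = 1 expected by [primitive_comp_onem]. *)
move=> sD; rewrite -[RHS]mul1r -[X in arcsinhpq _ _ X]mul1r; move: s sD.
apply: (primitive_comp_onem _ _ _ _ _ _ _ (regular_sinh_integrand (q / 2) q q0)
  (regular_sin_integrand q' q q0)) => //.
  move=> s sD; have /andP[S0 S1] := S01 _ sD.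
  move: sD; rewrite !in_itv/= => /andP[s0 ss].
  by rewrite !mulr_gt0 ?powR_gt0//= subr_gt0.
move=> s /[dup]sD /S01/andP[S0 S1].
move: sD; rewrite !in_itv/= => /andP[s0 ss].
have T0 : 0 < 1 - s `^ q by lra.
rewrite integrandE mul1r powRM ?powR_ge0 ?(ltW s0)//.
rewrite -powRrM mulNr mulVf ?gt_eqF// powR_inv1 ?(ltW T0)//.
rewrite (_ : 1 + _ = (1 - s `^ q)^-1); last by field; lra.
rewrite powRVl ?(ltW T0)// invrK mulN1r opprK subrK mulr1.
rewrite -powRD; last by rewrite (gt_eqF T0) implybT.
by congr (_ `^ _); field; rewrite gt_eqF.
Qed.

(** With U = u^q, 1 + 4U/(1 - U)^2 = ((1 + U)/(1 - U))^2, and twice the exponent (q + 2)/(2q) is 2/q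
    + 1. It serves both the integrand of [arcsinh_comp] and the final cosh formula. *)
Lemma cosh_double (u : R) : 0 <= u -> u `^ q < 1 ->
  (1 + (c * (u * (1 - u `^ q) `^ (- (2 / q)))) `^ q) `^ (2 * q / (q + 2))^-1 =
  ((1 + u `^ q) / (1 - u `^ q)) `^ (2 / q + 1).
Proof.
move=> u0 u1; have U0 : 0 <= u `^ q by rewrite powR_ge0.
have T0 : 0 < 1 - u `^ q by rewrite subr_gt0.
rewrite ![in LHS]powRM ?powR_ge0 ?mulr_ge0 ?powR_ge0// cq -powRrM.
have -> : - (2 / q) * q = - 2 by rewrite mulNr divfK ?gt_eqF.
rewrite powRN (powR_mulrn 2) ?(ltW T0)//.
rewrite (_ : 1 + _ = ((1 + u `^ q) / (1 - u `^ q)) ^+ 2); last by field; lra.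
have X0 : 0 <= (1 + u `^ q) / (1 - u `^ q) by apply: divr_ge0; lra.
rewrite powR_sqr//; congr (_ `^ _).
by field; have := q0; lra.
Qed.

(** The derivative factor 1 + s^q lowers the exponent 2/q + 1 of 1 + s^q to 2/q, while the powers of
    1 - s^q cancel. *)
Lemma arcsinh_comp (s : R) : s \in `[0, 1[ ->
  arcsinhpq (2 * q / (q + 2)) q (c * (s * (1 - s `^ q) `^ (- (2 / q)))) =
  c * arcsinhpq (q / 2) q s.
Proof.
move: s; apply: (primitive_comp_onem _ _ _ _ _ _ _
  (regular_sinh_integrand (2 * q / (q + 2)) q q0)
  (regular_sinh_integrand (q / 2) q q0)) => //.
  move=> s sD; have /andP[S0 S1] := S01 _ sD.
  move: sD; rewrite !in_itv/= => /andP[s0 ss].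
  by rewrite !mulr_gt0 ?powR_gt0//= subr_gt0.
move=> s /[dup]sD /S01/andP[S0 S1].
move: sD; rewrite !in_itv/= => /andP[s0 ss].
have T0 : 0 < 1 - s `^ q by lra.
have A0 : 0 < 1 + s `^ q by lra.
rewrite cosh_double ?(ltW s0)//.
rewrite powRM ?invr_ge0 ?ltW// powRVl ?ltW//.
rewrite -(powR_mul_subr1 _ (2 / q + 1) A0) addrK.
rewrite (_ : - (2 / q) - 1 = - (2 / q + 1)); last by ring.
rewrite powRN [(q / 2)^-1]invf_div.
by field; rewrite ?gt_eqF ?powR_gt0.
Qed.

(** Transports the limit through the inverse substitution: near 1, [arcsinpq 2 q y] equals
    [c * arcsinpq q' q (s y)], and [s y] tends to [sg], where the primitive is continuous. *)
Lemma arcsin2q_cvg1 : arcsinpq 2 q @ 1^'- --> c * arcsinpq q' q sg.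
Proof.
pose w (y : R) := (1 - y `^ q) `^ 2^-1.
(* s inverts t |-> c t (1 - t^q)^(1/q) on [0, sg[. *)
pose s y := ((1 - w y) / 2) `^ q^-1.
have w0 : w y @[y --> (1 : R)^'-] --> 0.
  by apply: onem_powR_cvg0; rewrite ?invr_gt0.
have s0 : s y @[y --> (1 : R)^'-] --> sg.
  apply: cvg_powR => //; rewrite -[X in _ --> X]mul1r; apply: cvgM.
    by rewrite -[X in _ --> X]subr0; apply: cvgB => //; exact: cvg_cst.
  exact: cvg_cst.
have : c * arcsinpq q' q (s y) @[y --> (1 : R)^'-] --> c * arcsinpq q' q sg.
  apply: cvgM; first exact: cvg_cst.
  apply: (cvg_comp _ _ s0).
  apply: (primitive_continuous (regular_sin_integrand q' q q0)).
  by rewrite in_itv/= sg_lt1 ltW.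
apply: cvg_trans; apply: near_eq_cvg; near=> y.
have y0 : 0 < y by near: y; exact: nbhs_left_gt.
have Y0 : 0 < y `^ q by rewrite powR_gt0.
have Y1 : y `^ q < 1 by rewrite powq_lt1// ltW.
have wy0 : 0 < w y by rewrite powR_gt0// subr_gt0.
have wy2 : w y ^+ 2 = 1 - y `^ q.
  by rewrite -(powR_mulrn 2) ?ltW// powRVK// subr_ge0 ltW.
have wy1 : w y < 1 by nra.
have sq : s y `^ q = (1 - w y) / 2 by rewrite powRVK ?gt_eqF//; lra.
have s_ge0 : 0 <= s y by rewrite powR_ge0.
rewrite -arcsin2q_comp.
  (* Equality with y is checked on q-th powers: 4 (1 - w)/2 (1 + w)/2 = 1 - w^2 = y^q. *)
  congr arcsinpq; apply: (powR_injective q0); rewrite ?nnegrE ?mulr_ge0 ?powR_ge0 ?(ltW y0)//.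
  rewrite powR_onem_double// sq; last lra.
  by rewrite -[RHS](subKr 1) -wy2; field.
rewrite in_itv/= s_ge0/=; apply: gt0_ltr_powR; rewrite ?invr_gt0// ?nnegrE; lra.
Unshelve. all: by end_near. Qed.

Lemma pipq_2q : pipq 2 q = (2 * (c * arcsinpq q' q sg))%:E.
Proof. exact/pipq_cvg/arcsin2q_cvg1. Qed.

End identities.

(** * The double-angle formulas *)

Theorem theorem1p4 (R : realType) (q : R) (hq : 1 < q) :
  let q' := q / (q - 1) in
  let c := 2 `^ (2 / q) in
  (pipq 2 q * ((2 `^ (2 / q + 1))^-1)%:E = pipq q' q * (4^-1)%:E)%E /\
  forall x : R, 0 <= x -> (x%:E < pipq q' q * (4^-1)%:E)%E ->
    [/\ sinpq 2 q (c * x) =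
          c * sinpq q' q x * (cospq q' q x) `^ (q' - 1),
        cospq 2 q (c * x) =
          (cospq q' q x) `^ q' - (sinpq q' q x) `^ q,
        sinhpq (2 * q / (q + 2)) q (c * x) =
          c * sinhpq (q / 2) q x
            / (1 - (sinhpq (q / 2) q x) `^ q) `^ (2 / q)
      & coshpq (2 * q / (q + 2)) q (c * x) =
          ((1 + (sinhpq (q / 2) q x) `^ q)
            / (1 - (sinhpq (q / 2) q x) `^ q)) `^ (2 / q + 1)].
Proof.
move=> q' c; have q0 : 0 < q by exact: lt_trans hq.
have c0 : 0 < c by rewrite powR_gt0.
have q'0 : 0 < q' by rewrite divr_gt0// subr_gt0.
pose sg := (2^-1 : R) `^ q^-1.
have sg0 : 0 < sg by rewrite powR_gt0.
have sg1 : sg < 1 by apply: powR_lt1; rewrite ?invr_gt0//; lra.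
have sgq : sg `^ q = 2^-1 by rewrite powRVK ?gt_eqF.
rewrite pipq_2q// pipq_conj// -!EFinM; split.
  rewrite -(powR_mul_subr1 _ (2 / q + 1)) ?ltr0n// addrK -/c; congr _%:E.
  by field; rewrite gt_eqF.
move=> x x0; rewrite lte_fin (_ : _ / 4 = arcsinpq q' q sg); last by field.
move=> xsg.
(* The intermediate value theorem parametrizes x as [arcsinpq q' q s]; since x is strictly below the
   value at [sg], also s < [sg]. *)
have [||s /[!in_itv]/= /andP[s0 ss] Fs] := @IVT _ (arcsinpq q' q) 0 sg x (ltW sg0).
- apply: continuous_in_subspaceT => t /[!inE]/= /[!in_itv]/= /andP[t0 ts].
  apply: (primitive_continuous (regular_sin_integrand q' q q0)).
  by rewrite in_itv/= t0 (le_lt_trans ts).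
- by rewrite {1 3}/arcsinpq !primitive0 ge_min le_max x0 (ltW xsg) orbT.
have {}ss : s < sg.
  by rewrite lt_neqAle ss andbT; apply: contraTneq xsg => <-; rewrite Fs ltxx.
have s1 := lt_trans ss sg1.
have sD : s \in `[0, 1[ by rewrite in_itv/= s0.
have S0 : 0 <= s `^ q by rewrite powR_ge0.
have S1 : s `^ q < 2^-1.
  by rewrite -sgq; apply: gt0_ltr_powR; rewrite // nnegrE ltW.
have T0 : 0 < 1 - s `^ q by lra.
have q'V : q'^-1 = 1 - q^-1 by rewrite /q'; field; lra.
have sinx : sinpq q' q x = s by rewrite -Fs arcsinpqK.
have cosx : cospq q' q x = (1 - s `^ q) `^ q'^-1 by rewrite -Fs cospq_arcsinpq.
pose phi := c * (s * (1 - s `^ q) `^ q^-1).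
have phi_ge0 : 0 <= phi by rewrite !mulr_ge0 ?powR_ge0.
have phiq : phi `^ q = 4 * (s `^ q * (1 - s `^ q)).
  by rewrite powR_onem_double//; lra.
have S2 : 0 < (1 - 2 * s `^ q) ^+ 2 by rewrite exprn_gt0//; lra.
have phi1 : phi < 1 by apply: (powR_lt1_inv _ _ q0 phi_ge0); rewrite phiq; nra.
have phiD : phi \in `[0, 1[ by rewrite in_itv/= phi_ge0.
have Fphi : c * x = arcsinpq 2 q phi.
  by rewrite arcsin2q_comp// ?Fs// in_itv/= s0.
pose u := s * (1 - s `^ q) `^ (- q^-1).
have u_ge0 : 0 <= u by rewrite !mulr_ge0 ?powR_ge0.
have uq : u `^ q = s `^ q / (1 - s `^ q).
  by rewrite powRM ?powR_ge0// -powRrM mulNr mulVf ?gt_eqF// powR_inv1 ?(ltW T0).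
(* S/(1 - S) < 1 because S = s^q < 1/2; this puts u in the range of [arcsinh_comp]. *)
have u1 : u < 1.
  apply: (powR_lt1_inv _ _ q0 u_ge0); rewrite uq ltr_pdivrMr// mul1r; lra.
have xu : x = arcsinhpq (q / 2) q u.
  by rewrite (arcsinhhalf_comp _ hq _ sD) Fs.
have sinhx : sinhpq (q / 2) q x = u by rewrite xu arcsinhpqK// in_itv/= u_ge0.
pose psi := c * (u * (1 - u `^ q) `^ (- (2 / q))).
have psi_ge0 : 0 <= psi by rewrite !mulr_ge0 ?powR_ge0.
have Gpsi : c * x = arcsinhpq (2 * q / (q + 2)) q psi.
  by rewrite arcsinh_comp// -?xu// in_itv/= u_ge0.
have U1 : u `^ q < 1 by rewrite powR_lt1.
have U0 : 0 <= u `^ q by rewrite powR_ge0.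
rewrite sinx cosx sinhx; split.
(* The exponents agree: (q' - 1)/q' = 1 - 1/q' = 1/q. *)
- rewrite Fphi (arcsinpqK _ _ q0 phi phiD) -powRrM -mulrA.
  congr (_ * (_ * _ `^ _)).
  by rewrite mulrBr mulVf ?gt_eqF// q'V; ring.
(* Both sides equal 1 - 2 s^q, which is nonnegative and hence the square root of its square. *)
- rewrite Fphi (cospq_arcsinpq _ _ q0 _ phiD) phiq.
  rewrite [X in _ = X - _](powRVK _ q' (ltW T0)) ?(gt_eqF q'0)//.
  have -> : 1 - 4 * (s `^ q * (1 - s `^ q)) = (1 - 2 * s `^ q) ^+ 2 by ring.
  by rewrite powR_sqr_half; [ring|lra].
- by rewrite Gpsi arcsinhpqK ?in_itv/= ?psi_ge0// /psi powRN mulrA.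
- by rewrite Gpsi coshpq_arcsinhpq ?in_itv/= ?psi_ge0// cosh_double.
Qed.
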